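(* Let $f:M\to\mathbb{R}^4$ be isothermic, $\varrho\in\mathbb{C}\setminus\{0\}$, and let $\varphi_1,\varphi_2$ be two $\mathrm{d}_\varrho$-parallel sections such that $W\oplus Wj=\tilde M\times\mathbb{H}^2$ where $W=\mathrm{span}_{\mathbb{C}}\{\varphi_1,\varphi_2\}$. Let $f_1=r_{E_1,\varrho}(f)$ and $f_2=r_{E_2,\varrho}(f)$ be the $\varrho$-Darboux transforms given by $E_1=\varphi_1\mathbb{C}$ and $E_2=\varphi_2\mathbb{C}$ respectively. Then the 2-step simple factor dressing $\hat f=r_{W,\varrho}(f)$ of $f$ is a common $\varrho$-Darboux transform of $f_1$ and $f_2$.
   Context: $\mathbb{H}=\mathrm{span}_{\mathbb{R}}\{1,i,j,k\}=\mathbb{R}^4$, $\mathbb{C}=\mathrm{span}_{\mathbb{R}}\{1,i\}$; $\mathbb{H}^2=\mathbb{C}^4$ with complex scalars acting by right multiplication. $M$ is a Riemann surface with universal cover $\tilde M$. Maps into $\mathbb{HP}^1$ are identified with quaternionic line subbundles of the trivial $\mathbb{H}^2$-bundle. A (possibly branched) conformal immersion $f:M\to\mathbb{R}^4$ is isothermic if there is a branched conformal immersion $f^d:\tilde M\to\mathbb{R}^4$ (a dual surface, fixed in the following) with $df\wedge df^d=df^d\wedge df=0$; round spheres are excluded. Put $e=\begin{pmatrix}1\\0\end{pmatrix}$, $\psi=\begin{pmatrix}f\\1\end{pmatrix}$, $\tilde L=\psi\mathbb{H}$ (over $\tilde M$). The associated family is $\mathrm{d}_\lambda\varphi=d\varphi+\eta\varphi\lambda$,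 $\lambda\in\mathbb{C}$, with $\eta=\begin{pmatrix} f\,df^d & -f\,df^d f\\ df^d&-df^d f\end{pmatrix}$; $\varphi=e\alpha+\psi\beta$ is $\mathrm{d}_\varrho$-parallel iff $d\alpha=-df\,\beta$, $d\beta=-df^d\,\alpha\varrho$. For such $\varphi$ with $\varphi\mathbb{H}\oplus\tilde L=\tilde M\times\mathbb{H}^2$, the $\varrho$-Darboux transform $D_{\varphi,\varrho}(f)$ is the surface with line bundle $\varphi\mathbb{H}$ (affine coordinate $f+\alpha\beta^{-1}$); it coincides with the simple factor dressing $r_{E,\varrho}(f)$, $E=\varphi\mathbb{C}$. It is isothermic, with dual surface $f^d+\beta\varrho^{-1}\alpha^{-1}$, and $\varrho$-Darboux transforms of it are formed with this dual surface. 2-step simple factor dressing: for a complex rank 2, $\mathrm{d}_\varrho$-parallel bundle $W$ with $W\oplus Wj=\tilde M\times\mathbb{C}^4$ and projections $\pi_W,\pi_{Wj}$, let $r^W_\varrho(\lambda)=\pi_W\gamma_\varrho(\lambda)+\pi_{Wj}$, $\gamma_\varrho(\lambda)=\frac{\bar\varrho(\varrho-\lambda)}{\varrho(\bar\varrho-\lambda)}$ acting by right multiplication; then $r_{W,\varrho}(f)$ is the surface with line bundle $r^W_\varrho(\infty)\tilde L$, where $r^W_\varrho(\infty)=\pi_W\frac{\bar\varrho}{\varrho}+\pi_{Wj}$. *)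

(* Defs.v *)
From HB Require Import structures.
From mathcomp Require Import all_boot all_order all_algebra.
From mathcomp Require Import complex ring lra.
From mathcomp Require Import boolp classical_sets functions reals topology.
From mathcomp Require Import normedtype derive.

Set Implicit Arguments.
Unset Strict Implicit.
Unset Printing Implicit Defensive.
Import Order.TTheory GRing.Theory Num.Theory.
Import numFieldNormedType.Exports.
Local Open Scope classical_set_scope.
Local Open Scope ring_scope.
Local Open Scope complex_scope.

(** * Quaternions *)

(* The underlying normed module is R^4 (with the sup norm, which only matters
   through its topology); the coordinates are those of 1, i, j, k. *)
Definition quat (R : realType) : Type := 'rV[R]_4.

HB.instance Definition _ (R : realType) := NormedModule.copy (quat R) 'rV[R]_4.

Section QuaternionAlgebra.
Context {R : realType}.
Implicit Types (a b c d : R) (x y z : quat R).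

Definition mkq a b c d : quat R := \row_(i < 4) [:: a; b; c; d]`_i.

Definition qcoord x (i : nat) : R := (x : 'rV[R]_4) 0 (inord i).

Local Notation "x .[ i ]" := (qcoord x i%N) : ring_scope.

Lemma qcoord_mkq a b c d (i : nat) : (i < 4)%N ->
  qcoord (mkq a b c d) i = [:: a; b; c; d]`_i.
Proof. by move=> i4; rewrite /qcoord mxE inordK. Qed.

Lemma quatP x y : x.[0] = y.[0] -> x.[1] = y.[1] -> x.[2] = y.[2] ->
  x.[3] = y.[3] -> x = y.
Proof.
rewrite /qcoord => e0 e1 e2 e3; apply/rowP => -[] m m4.
have -> : Ordinal m4 = inord m by apply/val_inj; rewrite /= inordK.
by case: m m4 => [|[|[|[|//]]]].
Qed.

Definition mulq x y : quat R :=
  mkq (x.[0] * y.[0] - x.[1] * y.[1] - x.[2] * y.[2] - x.[3] * y.[3])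
      (x.[0] * y.[1] + x.[1] * y.[0] + x.[2] * y.[3] - x.[3] * y.[2])
      (x.[0] * y.[2] - x.[1] * y.[3] + x.[2] * y.[0] + x.[3] * y.[1])
      (x.[0] * y.[3] + x.[1] * y.[2] - x.[2] * y.[1] + x.[3] * y.[0]).

(* The Euclidean inner product of R^4. *)
Definition dotq x y : R :=
  x.[0] * y.[0] + x.[1] * y.[1] + x.[2] * y.[2] + x.[3] * y.[3].

Definition invq x : quat R :=
  if x == 0 then 0
  else (dotq x x)^-1 *: mkq x.[0] (- x.[1]) (- x.[2]) (- x.[3]).

Lemma qcoordD x y i : (x + y).[i] = x.[i] + y.[i].
Proof. by rewrite /qcoord mxE. Qed.

Lemma qcoordN x i : (- x).[i] = - x.[i].
Proof. by rewrite /qcoord mxE. Qed.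

Lemma qcoordZ a x i : (a *: x).[i] = a * x.[i].
Proof. by rewrite /qcoord mxE. Qed.

Lemma qcoord0 i : (0 : quat R).[i] = 0.
Proof. by rewrite /qcoord mxE. Qed.

Definition qE := (qcoordD, qcoordN, qcoordZ, qcoord0).

Lemma dotq_eq0 x : (dotq x x == 0) = (x == 0).
Proof.
apply/eqP/eqP => [|->]; last by rewrite /dotq !qE; lra.
have H0 := sqr_ge0 x.[0]; have H1 := sqr_ge0 x.[1].
have H2 := sqr_ge0 x.[2]; have H3 := sqr_ge0 x.[3].
rewrite /dotq -!expr2 => e.
by apply: quatP; rewrite qE; apply/eqP; rewrite -sqrf_eq0; apply/eqP; lra.
Qed.

Let mulqA : associative mulq.
Proof. by move=> x y z; apply: quatP; rewrite /mulq !qcoord_mkq//=; ring. Qed.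

Let mul1q : left_id (mkq 1 0 0 0) mulq.
Proof. by move=> x; apply: quatP; rewrite /mulq !qcoord_mkq//=; ring. Qed.

Let mulq1 : right_id (mkq 1 0 0 0) mulq.
Proof. by move=> x; apply: quatP; rewrite /mulq !qcoord_mkq//=; ring. Qed.

Let mulqDl : left_distributive mulq +%R.
Proof.
by move=> x y z; apply: quatP; rewrite /mulq !(qE, qcoord_mkq)//=; ring.
Qed.

Let mulqDr : right_distributive mulq +%R.
Proof.
by move=> x y z; apply: quatP; rewrite /mulq !(qE, qcoord_mkq)//=; ring.
Qed.

Let oneq_neq0 : mkq 1 0 0 0 != 0.
Proof.
apply/eqP => /(congr1 (qcoord ^~ 0%N)); rewrite qcoord_mkq// qE /= => /eqP.
by rewrite oner_eq0.
Qed.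

HB.instance Definition _ := GRing.Zmodule_isNzRing.Build (quat R)
  mulqA mul1q mulq1 mulqDl mulqDr oneq_neq0.

Lemma mulqE x y : x * y = mulq x y. Proof. by []. Qed.

Lemma oneqE : 1 = mkq 1 0 0 0. Proof. by []. Qed.

Let mulVq : {in [pred x : quat R | x != 0], left_inverse 1 invq *%R}.
Proof.
move=> x /[!inE] x0; rewrite /invq (negbTE x0).
have : dotq x x != 0 by rewrite dotq_eq0.
by rewrite /dotq => d0; apply: quatP;
  rewrite mulqE oneqE /mulq !(qE, qcoord_mkq)//=;
  field.
Qed.

Let divqq : {in [pred x : quat R | x != 0], right_inverse 1 invq *%R}.
Proof.
move=> x /[!inE] x0; rewrite /invq (negbTE x0).
have : dotq x x != 0 by rewrite dotq_eq0.
by rewrite /dotq => d0; apply: quatP;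
  rewrite mulqE oneqE /mulq !(qE, qcoord_mkq)//=;
  field.
Qed.

Let unitqP x y : y * x = 1 /\ x * y = 1 -> [pred x : quat R | x != 0] x.
Proof.
move=> [yx _]; apply/negP => /eqP x0; move: yx; rewrite x0 mulr0 => /eqP.
by rewrite eq_sym oner_eq0.
Qed.

Let invq_out : {in [predC [pred x : quat R | x != 0]], invq =1 id}.
Proof. by move=> x /[!inE] /negPn /eqP ->; rewrite /invq eqxx. Qed.

HB.instance Definition _ := GRing.NzRing_hasMulInverse.Build (quat R)
  mulVq divqq unitqP invq_out.

Lemma unitqE x : (x \is a GRing.unit) = (x != 0). Proof. by []. Qed.

(* The inclusion of span {1, i} = C into the quaternions. *)
Definition qC (z : R[i]) : quat R := let: a +i* b := z in mkq a b 0 0.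

Definition qj : quat R := mkq 0 0 1 0.

End QuaternionAlgebra.

(** * Riemann surfaces *)

Section RiemannSurfaces.
Context {R : realType}.

(* The complex plane is identified with R * R via (x, y) |-> x + i y. *)
Definition holomorphic_at (h : R * R -> R * R) (z : R * R) : Prop :=
  differentiable h z /\
  'd h z (0, 1) = (- ('d h z (1, 0)).2, ('d h z (1, 0)).1).

(* A homeomorphism from an open subset of T onto an open subset of the plane;
   cmap and cinv are total, their values outside these sets are irrelevant. *)
Record chart (T : topologicalType) := Chart {
  cdom : set T;
  cmap : T -> R * R;
  cinv : R * R -> T;
  cdom_open : open cdom;
  cimg_open : open (cmap @` cdom);
  cmapK : forall p, cdom p -> cinv (cmap p) = p;
  cmap_continuous : forall p, cdom p -> {for p, continuous cmap};
  cinv_continuous : forall z, (cmap @` cdom) z -> {for z, continuous cinv} }.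

Definition cimg (T : topologicalType) (c : chart T) : set (R * R) :=
  cmap c @` cdom c.

End RiemannSurfaces.

(* Second countability is automatic (Rado) and hence not required. *)
Record riemannSurface (R : realType) := RiemannSurface {
  rs_sort :> topologicalType;
  rs_hausdorff : hausdorff_space rs_sort;
  rs_connected : connected [set: rs_sort];
  atlas : set (@chart R rs_sort);
  atlas_cover : forall p : rs_sort, exists2 c, atlas c & cdom c p;
  atlas_holomorphic : forall c c', atlas c -> atlas c' ->
    forall p, cdom c p -> cdom c' p ->
      holomorphic_at (cmap c' \o cinv c) (cmap c p) }.

Section Covering.
Context {R : realType}.
Implicit Types M N Mt : riemannSurface R.

Definition holomorphic_map N M (pr : N -> M) : Prop :=
  continuous pr /\
  forall c c' p, atlas c -> cdom c p -> atlas c' -> cdom c' (pr p) ->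
    holomorphic_at (cmap c' \o pr \o cinv c) (cmap c p).

Definition covering_map (T S : topologicalType) (pr : T -> S) : Prop :=
  continuous pr /\
  forall x : S, exists U : set S, [/\ open U, U x &
    exists (I : Type) (V : I -> set T) (s : I -> S -> T),
      [/\ forall i, open (V i), trivIset [set: I] V,
          pr @^-1` U = \bigcup_i V i &
          forall i, [/\ pr @` V i = U,
            forall p, V i p -> s i (pr p) = p &
            forall y, U y -> {for y, continuous (s i)}]]].

Local Notation I01 := [set t : R | 0 <= t <= 1].

(* Every loop is contractible relative to its base point; connectedness is part
   of riemannSurface. *)
Definition simply_connected (T : topologicalType) : Prop :=
  forall g : R -> T, {within I01, continuous g} -> g 0 = g 1 ->
  exists H : R * R -> T, [/\ {within I01 `*` I01, continuous H},
    forall t, I01 t -> H (0, t) = g t,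
    forall t, I01 t -> H (1, t) = g 0 &
    forall s, I01 s -> H (s, 0) = g 0 /\ H (s, 1) = g 0].

Definition universal_cover M Mt (pr : Mt -> M) : Prop :=
  [/\ simply_connected Mt, covering_map pr, (forall x, exists p, pr p = x) &
      holomorphic_map pr].

End Covering.

(** * Calculus on Riemann surfaces *)

Section Calculus.
Context {R : realType} (N : riemannSurface R) (V : normedModType R).
Implicit Types (g : N -> V) (c : @chart R N) (p : N) (v : R * R).

Definition is_chart_at p c : Prop := atlas c /\ cdom c p.

(* The value of dg at p on the tangent vector with coordinates v in c. *)
Definition dchart g c p v : V := 'd (g \o cinv c) (cmap c p) v.

Definition differentiable_rs g p : Prop :=
  forall c, is_chart_at p c -> differentiable (g \o cinv c) (cmap c p).

(* All iterated partial derivatives exist and are differentiable. *)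
Definition smooth_on (A : set (R * R)) (h : R * R -> V) : Prop :=
  forall (s : seq (R * R)) z, A z ->
    differentiable (foldr (fun v (k : R * R -> V) => 'D_v k) h s) z.

Definition smooth g : Prop :=
  forall c, atlas c -> smooth_on (cimg c) (g \o cinv c).

Definition immersed_at g p : Prop :=
  forall c, is_chart_at p c -> forall v, v != 0 -> dchart g c p v != 0.

End Calculus.

(** * Isothermic surfaces in R^4 = H *)

Section Isothermic.
Context {R : realType}.
Implicit Types M N Mt : riemannSurface R.

Definition conformal_at N (g : N -> quat R) (p : N) : Prop :=
  forall c, is_chart_at p c ->
    let gx := dchart g c p (1, 0) in let gy := dchart g c p (0, 1) in
    dotq gx gy = 0 /\ dotq gx gx = dotq gy gy.

Definition branched_conformal_immersion N (g : N -> quat R) : Prop :=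
  [/\ smooth g, forall p, conformal_at g p &
      forall p, \forall q \near p^', immersed_at g q].

(* dg /\ dh = 0 as quaternion-valued 2-forms. *)
Definition wedge0 N (g h : N -> quat R) : Prop :=
  forall p c v w, is_chart_at p c ->
    dchart g c p v * dchart h c p w - dchart g c p w * dchart h c p v = 0.

(* A round 2-sphere: a 3-sphere cut by a hyperplane through its centre. *)
Definition round_sphere (S : set (quat R)) : Prop :=
  exists (m n : quat R) (r : R), [/\ n != 0, 0 < r &
    S = [set x | dotq (x - m) (x - m) = r ^+ 2 /\ dotq (x - m) n = 0]].

Definition isothermic_with_dual M Mt (pr : Mt -> M) (f : M -> quat R)
    (fd : Mt -> quat R) : Prop :=
  [/\ branched_conformal_immersion f,
      ~ (exists2 S, round_sphere S & range f `<=` S),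
      branched_conformal_immersion fd,
      wedge0 (f \o pr) fd & wedge0 fd (f \o pr)].

End Isothermic.

(** * Quaternionic line bundles, parallel sections, Darboux transforms *)

Section Darboux.
Context {R : realType}.

Definition H2 (R : realType) : Type := (quat R * quat R)%type.

Implicit Types (v w : H2 R) (q x y : quat R) (A B : set (H2 R)).

(* Scalars act on H^2 from the right. *)
Definition scaler2 v q : H2 R := (v.1 * q, v.2 * q).
Local Notation "v *r q" := (scaler2 v q) (at level 40, left associativity).

Definition qline v : set (H2 R) := range (scaler2 v).

Definition evec : H2 R := (1, 0).
Definition psivec x : H2 R := (x, 1).

Definition direct_sum_full A B : Prop :=
  forall v, exists! ab : H2 R * H2 R, [/\ A ab.1, B ab.2 & v = ab.1 + ab.2].

(* A point of HP^1, i.e. a quaternionic line in H^2, is finite if it is not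
   the point at infinity eH; it is then psivec x H for its affine
   coordinate x. *)
Definition finite_line A : Prop := ~ A evec.
Definition affine_coord A : quat R := xget 0 [set x | A (psivec x)].

Lemma affine_coord_psi x : affine_coord (qline (psivec x)) = x.
Proof.
rewrite /affine_coord; case: xgetP => [y -> /= [q _]|/(_ x)[]]; last first.
  by exists 1 => //; rewrite /scaler2/= !mulr1.
by rewrite /scaler2/= mul1r => -[+ q1]; rewrite q1 mulr1.
Qed.

Variable N : riemannSurface R.
Implicit Types (L : N -> set (H2 R)) (f fd : N -> quat R) (phi : N -> H2 R).

(* The value at X of the connection form
     eta = ((f dfd, - f dfd f), (dfd, - dfd f))
   applied to v, where a = f p and om = dfd p X. *)
Definition eta_form (a om : quat R) v : H2 R :=
  (a * om * v.1 - a * om * a * v.2, om * v.1 - om * a * v.2).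

(* d_rho phi = d phi + eta phi rho = 0 for the surface in HP^1 with line
   bundle L and dual surface fd.  At points where the surface passes through
   infinity eta has no affine expression and only differentiability of phi is
   required; for the surfaces below these points are isolated, so that the
   equation extends to them by continuity.  Smoothness of phi follows from the
   equation. *)
Definition parallel_section L fd (rho : R[i]) phi : Prop :=
  (forall p, differentiable_rs phi p) /\
  (forall p, finite_line (L p) -> forall c X, is_chart_at p c ->
    dchart phi c p X +
      eta_form (affine_coord (L p)) (dchart fd c p X) (phi p) *r qC rho = 0).

Definition line_bundle phi : N -> set (H2 R) := fun p => qline (phi p).

Definition complementary phi L : Prop :=
  forall p, direct_sum_full (qline (phi p)) (L p).

(* The surface with line bundle Lhat is a rho-Darboux transform of the surface
   with line bundle L and dual surface fd. *)
Definition darboux_transform L fd (rho : R[i]) (Lhat : N -> set (H2 R)) :=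
  exists phi, [/\ parallel_section L fd rho phi, complementary phi L &
    Lhat = line_bundle phi].

(* The coordinates of phi = e alpha + psi beta. *)
Definition alpha f phi p : quat R := (phi p).1 - f p * (phi p).2.
Definition beta phi p : quat R := (phi p).2.

(* The dual surface of the rho-Darboux transform given by phi. *)
Definition darboux_dual f fd (rho : R[i]) phi p : quat R :=
  fd p + beta phi p * (qC rho)^-1 * (alpha f phi p)^-1.

(** * 2-step simple factor dressing *)

Definition cspan2 phi1 phi2 p : set (H2 R) :=
  [set v | exists z1 z2 : R[i], v = phi1 p *r qC z1 + phi2 p *r qC z2].

Definition rmulj A : set (H2 R) := [set v *r qj | v in A].

(* The projection onto A along B. *)
Definition proj_along A B v : H2 R := xget 0 [set a | A a /\ B (v - a)].

Definition dressing_infty (rho : R[i]) A v : H2 R :=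
  proj_along A (rmulj A) v *r qC (conjc rho / rho) + proj_along (rmulj A) A v.

Definition simple_factor_dressing (rho : R[i]) (W L : N -> set (H2 R))
    : N -> set (H2 R) :=
  fun p => dressing_infty rho (W p) @` L p.

End Darboux.

(* Main.v *)
(* Write [phi_i = e alpha_i + psi beta_i] and
   [chi = rho^-1 alpha_1^-1 alpha_2 rho].  The section [u = phi_2 - phi_1 chi]
   satisfies [d u = - phi_1 d chi], and this is the parallel equation of the
   Darboux transform [f_1] with its dual surface.  On the other hand the
   dressing matrix acts on the quaternionic basis [phi_1, phi_2] by
   [phi_i x |-> phi_i rho^-1 x conj(rho)]; since
   [psi = phi_2 y - phi_1 alpha_1^-1 alpha_2 y] for some [y], the image of [psi]
   is [u rho^-1 y conj(rho)].  So [u] spans the line bundle of the 2-step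
   dressing, and exchanging [phi_1] and [phi_2] gives the second assertion. *)

Require Import Defs.
From HB Require Import structures.
From mathcomp Require Import all_boot all_order all_algebra.
From mathcomp Require Import complex ring.
From mathcomp Require Import boolp classical_sets functions reals topology.
From mathcomp Require Import normedtype landau derive.

Set Implicit Arguments.
Unset Strict Implicit.

Import Order.TTheory GRing.Theory Num.Theory.
Import numFieldNormedType.Exports.
Local Open Scope classical_set_scope.
Local Open Scope ring_scope.

(** * Derivatives of products and inverses of quaternion-valued maps *)

Section QuaternionCalculus.
Context {R : realType} {V : normedModType R}.
Implicit Types (g h dg dh : V -> quat R) (a b da db : V -> R) (z : V).

(** This and the next two rules are phrased with explicit lambdas so that they unify with the
    coordinate functions in [is_diff_mkq]. *)
Let is_diffDf a b da db z : is_diff z a da -> is_diff z b db ->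
  is_diff z (fun w => a w + b w) (fun v => da v + db v).
Proof. by move=> Ha Hb; exact: (is_diffD Ha Hb). Qed.

Let is_diffNf a da z : is_diff z a da ->
  is_diff z (fun w => - a w) (fun v => - da v).
Proof. by move=> Ha; exact: (is_diffN Ha). Qed.

Let is_diffMf a b da db z : is_diff z a da -> is_diff z b db ->
  is_diff z (fun w => a w * b w) (fun v => a z * db v + b z * da v).
Proof. by move=> Ha Hb; exact: (is_diffM Ha Hb). Qed.

Lemma is_diff_qcoord g dg z (i : nat) : is_diff z g dg ->
  is_diff z (fun w => qcoord (g w) i) (fun v => qcoord (dg v) i).
Proof.
move=> Hg.
have lin : linear (fun x : quat R => qcoord x i).
  by move=> k x y; rewrite !qE.
pose linM := GRing.isLinear.Build _ _ _ _ _ lin.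
pose linL : {linear quat R -> R} := HB.pack (fun x : quat R => qcoord x i) linM.
have cont : continuous linL by exact: coord_continuous.
have Hq : is_diff (g z) linL linL.
  by apply: DiffDef; [exact: linear_differentiable|exact: diff_lin].
exact: (is_diff_comp Hg Hq).
Qed.

Lemma is_diff_mkq a b (c d : V -> R) da db dc dd z :
  is_diff z a da -> is_diff z b db -> is_diff z c dc -> is_diff z d dd ->
  is_diff z (fun w => mkq (a w) (b w) (c w) (d w))
            (fun v => mkq (da v) (db v) (dc v) (dd v)).
Proof.
have H (e : quat R) (k dk : V -> R) : is_diff z k dk ->
    is_diff z (fun w => k w *: e) (fun v => dk v *: e).
  by move=> Hk; exact: (is_diff_comp Hk (is_diff_scalel (k z) e)).
have E (p q r s : R) : mkq p q r s = p *: mkq 1 0 0 0 + q *: mkq 0 1 0 0 +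
    r *: mkq 0 0 1 0 + s *: mkq 0 0 0 1.
  by apply: quatP; rewrite !qE !qcoord_mkq//=; ring.
move=> Ha Hb Hc Hd.
under [X in is_diff_def _ X]eq_fun do rewrite E.
under [X in is_diff_def _ _ X]eq_fun do rewrite E.
exact: (is_diffD (is_diffD (is_diffD (H _ _ _ Ha) (H _ _ _ Hb)) (H _ _ _ Hc))
                 (H _ _ _ Hd)).
Qed.

Lemma is_diff_mulq g h dg dh z : is_diff z g dg -> is_diff z h dh ->
  is_diff z (fun w => g w * h w) (fun v => dg v * h z + g z * dh v).
Proof.
move=> Hg Hh.
have G i := is_diff_qcoord i Hg; have H i := is_diff_qcoord i Hh.
have P i j := is_diffMf (G i) (H j).
apply: (is_diff_eq (is_diff_mkq
  (is_diffDf (is_diffDf (is_diffDf (P 0%N 0%N) (is_diffNf (P 1%N 1%N)))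
    (is_diffNf (P 2%N 2%N))) (is_diffNf (P 3%N 3%N)))
  (is_diffDf (is_diffDf (is_diffDf (P 0%N 1%N) (P 1%N 0%N))
    (P 2%N 3%N)) (is_diffNf (P 3%N 2%N)))
  (is_diffDf (is_diffDf (is_diffDf (P 0%N 2%N) (is_diffNf (P 1%N 3%N)))
    (P 2%N 0%N)) (P 3%N 1%N))
  (is_diffDf (is_diffDf (is_diffDf (P 0%N 3%N) (P 1%N 2%N))
    (is_diffNf (P 2%N 1%N))) (P 3%N 0%N)))).
apply/funext => v; apply: quatP;
  by rewrite !mulqE /mulq !qE !qcoord_mkq//=; ring.
Qed.

Lemma is_diff_invq g dg z : is_diff z g dg -> g z != 0 ->
  is_diff z (fun w => (g w)^-1) (fun v => - ((g z)^-1 * dg v * (g z)^-1)).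
Proof.
move=> Hg gz0.
have dg0 : dotq (g z) (g z) != 0 by rewrite dotq_eq0.
(* Both sides are [0] at [x = 0], so this is an equality of functions and differentiability
   transfers at once. *)
have invE (x : quat R) : x^-1 = mkq ((dotq x x)^-1 * qcoord x 0)
    (- ((dotq x x)^-1 * qcoord x 1)) (- ((dotq x x)^-1 * qcoord x 2))
    (- ((dotq x x)^-1 * qcoord x 3)).
  rewrite -[LHS]/(Defs.invq x) /Defs.invq; case: eqVneq => [->|_].
    by apply: quatP; rewrite !qE !qcoord_mkq // ?qE /= ?mulr0 ?oppr0.
  by apply: quatP; rewrite !qE !qcoord_mkq//=; ring.
have G i := is_diff_qcoord i Hg.
have P i := is_diffMf (G i) (G i).
have D : differentiable (fun w => dotq (g w) (g w)) z.
  by have [] := is_diffDf (is_diffDf (is_diffDf (P 0%N) (P 1%N)) (P 2%N)) (P 3%N).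
have C i := is_diffMf (differentiableP (differentiableV D dg0)) (G i).
have DI : is_diff z (fun w => (g w)^-1) ('d (fun w => (g w)^-1) z).
  apply: differentiableP.
  under [X in differentiable X _]eq_fun do rewrite invE.
  by have [] := is_diff_mkq (C 0%N) (is_diffNf (C 1%N)) (is_diffNf (C 2%N))
    (is_diffNf (C 3%N)).
(* [x x^-1 x = x] also holds at [x = 0], as [0^-1 = 0], so that it can be
   differentiated without restricting to a neighbourhood. *)
have := is_diff_mulq (is_diff_mulq Hg DI) Hg.
have E2 : (fun w => g w * (g w)^-1 * g w) = g.
  apply/funext => w; case: (eqVneq (g w) 0) => [->|w0]; first by rewrite mulr0.
  by rewrite divrK ?unitqE.
rewrite [X in is_diff_def _ X]E2 => -[_ E1]; have [_ dgE] := Hg.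
have gU : g z \is a GRing.unit by rewrite unitqE.
apply: (is_diff_eq DI); apply/funext => v.
have := congr1 (fun k : V -> quat R => k v) (etrans (esym E1) dgE).
cbv beta.
(* The equation becomes [y + g z * x * g z + y = y]; cancelling [y] and then [g z] on both sides
   isolates [x]. *)
move: ('d _ z v) (dg v) => x y; rewrite mulrDl divrK// mulrV// mul1r.
rewrite -addrA -{3}[y]addr0 => /addrI /eqP; rewrite addr_eq0 => /eqP e.
apply: (mulrI gU); apply: (mulIr gU).
by rewrite e mulrN mulNr !mulrA mulrV// mul1r divrK.
Qed.

End QuaternionCalculus.

(** * Differentiability in charts and along the covering map *)

Section ChartCalculus.
Context {R : realType}.

(** The first-order expansion of [g] at [z] is also one of [h]. This serves for chart identities,
    which hold only on chart domains. *)
Lemma near_differentiable (V W : normedModType R) (g h : V -> W) (z : V) :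
  (\forall w \near z, g w = h w) -> differentiable g z -> differentiable h z.
Proof.
move=> gh Dg; have gz : g z = h z by exact: nbhs_singleton gh.
have E : h \o shift z = cst (h z) + 'd g z +o_ 0 id.
  apply/eqaddoP => e e0; have /eqaddoP/(_ e e0) := diff_locally Dg.
  apply: filterS2; last first.
    by move: gh; rewrite (near_shift 0 z) /= subr0; exact.
  by move=> w /= ghw; rewrite -gz !fctE /= -ghw.
have Dc := diff_continuous Dg.
have dE : 'd h z = 'd g z :> (V -> W) by exact: diff_unique.
by apply/diff_locallyP; rewrite dE; split.
Qed.

Lemma is_diff_fst (U V W : normedModType R) (g dg : U -> V * W) (z : U) :
  is_diff z g dg -> is_diff z (fun w => (g w).1) (fun v => (dg v).1).
Proof.
move=> Hg; have H : is_diff (g z) (@fst V W) (@fst V W).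
  by apply: DiffDef; [apply: linear_differentiable|apply: diff_lin] => ?;
    exact: cvg_fst.
exact: (is_diff_comp Hg H).
Qed.

Lemma is_diff_snd (U V W : normedModType R) (g dg : U -> V * W) (z : U) :
  is_diff z g dg -> is_diff z (fun w => (g w).2) (fun v => (dg v).2).
Proof.
move=> Hg; have H : is_diff (g z) (@snd V W) (@snd V W).
  by apply: DiffDef; [apply: linear_differentiable|apply: diff_lin] => ?;
    exact: cvg_snd.
exact: (is_diff_comp Hg H).
Qed.

Lemma smooth_differentiable (N : riemannSurface R) (V : normedModType R)
  (g : N -> V) : smooth g -> forall p, differentiable_rs g p.
Proof. by move=> sg p c [cA cp]; apply: (sg c cA [::]); exists p. Qed.

(** Near the point, [pr] stays in the domain of one chart [c'] of [M], where inserting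
    [cinv c' \o cmap c'] reduces the claim to the chain rule. *)
Lemma differentiable_rs_comp (N M : riemannSurface R) (V : normedModType R)
  (pr : N -> M) (g : M -> V) : holomorphic_map pr ->
  (forall x, differentiable_rs g x) -> forall p, differentiable_rs (g \o pr) p.
Proof.
move=> [prc prh] Dg p c [cA cp].
have [c' c'A c'p] := atlas_cover (pr p).
have zc : cinv c (cmap c p) = p by exact: cmapK.
have [Dh _] := prh c c' p cA cp c'A c'p.
have D : differentiable ((g \o cinv c') \o (cmap c' \o pr \o cinv c)) (cmap c p).
  by apply: differentiable_comp => //=; rewrite zc; exact: Dg.
apply: near_differentiable D.
have cc : {for cmap c p, continuous (pr \o cinv c)}.
  by apply: continuous_comp; [apply: (@cinv_continuous _ _ c); exists p|exact: prc].
have H : nbhs (cmap c p) ((pr \o cinv c) @^-1` cdom c').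
  by apply: cc; apply: open_nbhs_nbhs; split; [exact: cdom_open|rewrite /= zc].
by apply: filterS H => w /= w'; rewrite cmapK.
Qed.
End ChartCalculus.

(** * Quaternionic lines and bases of the right module [H2] *)

Section QuaternionicLines.
Context {R : realType}.
Implicit Types (u v w : H2 R) (x y : quat R) (z : R[i]).

Local Notation "v *r q" := (scaler2 v q) (at level 40, left associativity).

Lemma qC1 : qC 1 = 1 :> quat R.
Proof. by []. Qed.

Lemma qCM z1 z2 : qC (z1 * z2) = qC z1 * qC z2.
Proof.
case: z1 z2 => [a b] [c d]; apply: quatP;
  rewrite mulqE /mulq !qcoord_mkq//=; ring.
Qed.

Lemma qC_neq0 z : z != 0 -> qC z != 0.
Proof.
move=> z0; apply/eqP => e; have := qCM z z^-1.
by rewrite mulfV// e mul0r qC1 => /eqP; rewrite oner_eq0.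
Qed.

Lemma qCV z : z != 0 -> qC z^-1 = (qC z)^-1.
Proof.
move=> z0; apply: (mulrI (x := qC z)); first by rewrite unitqE qC_neq0.
by rewrite mulrV ?unitqE ?qC_neq0// -qCM mulfV.
Qed.

Lemma mulq_qj_qC z : qj * qC z = qC (conjc z) * qj.
Proof.
by case: z => [a b]; apply: quatP; rewrite !mulqE /mulq !qcoord_mkq//=; ring.
Qed.

Lemma quat_split x : exists z1 z2, x = qC z1 + qC z2 * qj.
Proof.
exists (Complex (qcoord x 0) (qcoord x 1)), (Complex (qcoord x 2) (qcoord x 3)).
by apply: quatP; rewrite mulqE qE /mulq !qcoord_mkq//=; ring.
Qed.

Lemma scaler2M v x y : v *r x *r y = v *r (x * y).
Proof. by rewrite /scaler2 /= !mulrA. Qed.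

Lemma scaler2Dr v x y : v *r (x + y) = v *r x + v *r y.
Proof. by rewrite /scaler2 !mulrDr. Qed.

Lemma scaler2Nr v x : v *r (- x) = - (v *r x).
Proof. by rewrite /scaler2 !mulrN. Qed.

Lemma scaler2Dl v w x : (v + w) *r x = v *r x + w *r x.
Proof. by rewrite /scaler2 /= !mulrDl. Qed.

Lemma scaler2_1 v : v *r 1 = v.
Proof. by rewrite /scaler2 !mulr1 -surjective_pairing. Qed.

Lemma scaler2_0 v : v *r 0 = 0.
Proof. by rewrite /scaler2 !mulr0. Qed.

Lemma scaler20 x : (0 : H2 R) *r x = 0.
Proof. by rewrite /scaler2 !mul0r. Qed.

Lemma qline_scaler2 v x : x != 0 -> qline (v *r x) = qline v.
Proof.
move=> x0; apply/seteqP; split => [_ [y _ <-]|_ [y _ <-]].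
  by exists (x * y) => //; rewrite scaler2M.
by exists (x^-1 * y) => //; rewrite scaler2M mulVKr ?unitqE.
Qed.

(** Two spanning vectors of [H2] form a basis ([spans_free]), so this is a handier form of the
    direct sum of two lines. *)
Definition spans u v := forall w, exists x y, w = u *r x + v *r y.

Lemma spansC u v : spans u v -> spans v u.
Proof. by move=> uv w; have [x [y ->]] := uv w; exists y, x; rewrite addrC. Qed.

(** Otherwise [v] alone would generate [H2]: reaching [evec] forces [v.2 = 0], reaching [psivec 0]
    forbids it. *)
Lemma spans_not_qline u v : spans u v -> ~ qline v u.
Proof.
move=> uv [q _ uq].
have vH w : exists x, w = v *r x.
  have [x [y ->]] := uv w; exists (q * x + y).
  by rewrite scaler2Dr -uq scaler2M.
have [a [va1 va2]] := vH evec; have [b [_ vb2]] := vH (psivec 0).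
have a0 : a \is a GRing.unit.
  by rewrite unitqE; apply/eqP => a0; move: va1; rewrite a0 mulr0 => /eqP;
    rewrite oner_eq0.
have v2 : v.2 = 0 by apply: (mulIr a0); rewrite mul0r -va2.
by move: vb2; rewrite v2 mul0r => /eqP; rewrite oner_eq0.
Qed.

Lemma spans_free u v x y : spans u v -> u *r x + v *r y = 0 -> x = 0 /\ y = 0.
Proof.
move=> uv e.
have x0 : x = 0.
  apply/eqP/negP => /negP x0; apply: (spans_not_qline uv).
  exists (- (y * x^-1)) => //; rewrite scaler2Nr -scaler2M.
  have -> : v *r y = u *r - x.
    by rewrite scaler2Nr; apply/eqP; rewrite -addr_eq0 addrC e.
  by rewrite scaler2M mulNr mulrV ?unitqE// scaler2Nr opprK scaler2_1.
split=> //; move: e; rewrite x0 scaler2_0 add0r => vy.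
apply/eqP/negP => /negP y0; apply: (spans_not_qline (spansC uv)).
exists 0 => //; rewrite scaler2_0.
by rewrite -[v]scaler2_1 -(mulrV (x := y)) ?unitqE// -scaler2M vy scaler20.
Qed.

Lemma spans_direct_sum u v : spans u v <-> direct_sum_full (qline u) (qline v).
Proof.
split=> [uv w|uv w]; last first.
  have [[a b] [[[x _ <-] [y _ <-] ->] _]] := uv w; by exists x, y.
have [x [y ->]] := uv w; exists (u *r x, v *r y); split.
  by split=> //; [exists x|exists y].
move=> [a b] /= [[x' _ <-] [y' _ <-] e].
have [|/eqP] := @spans_free u v (x - x') (y - y') uv.
  by rewrite !scaler2Dr !scaler2Nr addrACA e -opprD subrr.
by rewrite subr_eq0 => /eqP -> /eqP; rewrite subr_eq0 => /eqP ->.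
Qed.

End QuaternionicLines.

(** * The dressing matrix at infinity on [W] and [W j] *)

Section Dressing.
Context {R : realType} (N : riemannSurface R).
Implicit Types (phi : N -> H2 R) (p : N) (rho : R[i]) (x y : quat R).

Local Notation "v *r q" := (scaler2 v q) (at level 40, left associativity).

Lemma cspan2C phi1 phi2 : cspan2 phi1 phi2 = cspan2 phi2 phi1.
Proof.
by apply/funext => p; apply/seteqP; split => v [z1 [z2 ->]]; exists z2, z1;
  rewrite addrC.
Qed.

(* The weights on [W] and [W j] act on quaternionic coefficients as the single
   twist [x |-> rho^-1 x conj(rho)]: the factors cancel on the [j]-part. *)
Lemma cspan2_split phi1 phi2 p x y : exists v w,
  [/\ cspan2 phi1 phi2 p v, rmulj (cspan2 phi1 phi2 p) w,
      phi1 p *r x + phi2 p *r y = v + w &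
      forall rho, rho != 0 ->
      phi1 p *r ((qC rho)^-1 * x * qC (conjc rho)) +
      phi2 p *r ((qC rho)^-1 * y * qC (conjc rho)) =
        v *r qC (conjc rho / rho) + w].
Proof.
have [x1 [x2 ->]] := quat_split x; have [y1 [y2 ->]] := quat_split y.
exists (phi1 p *r qC x1 + phi2 p *r qC y1),
  ((phi1 p *r qC x2 + phi2 p *r qC y2) *r qj); split.
- by exists x1, y1.
- by exists (phi1 p *r qC x2 + phi2 p *r qC y2) => //; exists x2, y2.
- by rewrite !scaler2Dl !scaler2M !scaler2Dr addrACA.
- move=> rho rho0.
  have E z1 z2 : (qC rho)^-1 * (qC z1 + qC z2 * qj) * qC (conjc rho) =
      qC z1 * qC (conjc rho / rho) + qC z2 * qj.
    rewrite mulrDr mulrDl -!mulrA mulq_qj_qC conjcK -qCV// !mulrA -!qCM.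
    by congr (qC _ + qC _ * _); field.
  by rewrite !E !scaler2Dl !scaler2M !scaler2Dr addrACA.
Qed.

Lemma spans_cspan2 phi1 phi2 p :
  direct_sum_full (cspan2 phi1 phi2 p) (rmulj (cspan2 phi1 phi2 p)) ->
  spans (phi1 p) (phi2 p).
Proof.
move=> WW v; have [[a b] [[[z1 [z2 /= ->]] [w [z3 [z4 ->]] /= <-] ->] _]] := WW v.
exists (qC z1 + qC z3 * qj), (qC z2 + qC z4 * qj).
by rewrite !scaler2Dl !scaler2M !scaler2Dr addrACA.
Qed.

(** Uniqueness of the decomposition forces the two values picked by [xget] to be [v] and [w]. *)
Lemma dressing_inftyE (A : set (H2 R)) rho v w :
  direct_sum_full A (rmulj A) -> A v -> rmulj A w ->
  dressing_infty rho A (v + w) = v *r qC (conjc rho / rho) + w.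
Proof.
move=> AA Av Aw; have [[a b] [_ U]] := AA (v + w).
have [av bw] : (a, b) = (v, w) by apply: U.
rewrite /dressing_infty /proj_along; congr (_ *r _ + _).
  case: xgetP => [c _ /= [Ac Ac']|/(_ v)[]].
    have [] : (a, b) = (c, v + w - c) by apply: U; split=> //=; rewrite subrKC.
    by rewrite av => <-.
  by split=> //; rewrite addrAC subrr add0r.
case: xgetP => [c _ /= [Ac Ac']|/(_ w)[]].
  have [] : (a, b) = (v + w - c, c) by apply: U; split=> //=; rewrite subrK.
  by rewrite bw => _ <-.
by split=> //; rewrite addrK.
Qed.

End Dressing.

(** The form has rank one: its image is the line of [psivec a], and it sees only the coordinate
    [v.1 - a * v.2], which vanishes on that line. *)
Lemma eta_formE {R : realType} (a om : quat R) (v : H2 R) :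
  eta_form a om v = (a * (om * (v.1 - a * v.2)), om * (v.1 - a * v.2)).
Proof. by rewrite /eta_form !mulrBr !mulrA. Qed.

(** Here [x1 * y1^-1] is the affine coordinate of the Darboux transform, so the multiple of [phi1]
    has zero coordinate and [k] drops out; the terms in [a] cancel. *)
Lemma affine_section_coord (T : unitRingType) (x1 y1 x2 y2 a k : T) :
  y1 \is a GRing.unit ->
  (x2 - x1 * k) - x1 * y1^-1 * (y2 - y1 * k) =
    (x2 - a * y2) - (x1 - a * y1) * y1^-1 * y2.
Proof.
move=> y1U; rewrite mulrBr mulrA divrK// !mulrBl mulrK// !opprB.
by rewrite addrA subrK [RHS]addrA subrK.
Qed.

(** With [d] for [df] and [r] for [rho], this matches the connection term of the transform with
    [beta1] times the differential of [transform_coef]. *)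
Lemma dual_differential_coord (T : unitRingType) (a1 b1 a2 b2 r d : T) :
  a1 \is a GRing.unit -> b1 \is a GRing.unit ->
  b1 * r^-1 * a1^-1 * d * b1 * a1^-1 * (a2 - a1 * b1^-1 * b2) * r =
    b1 * (r^-1 * a1^-1 * d * (b1 * a1^-1 * a2 - b2) * r).
Proof. by move=> a1U b1U; rewrite !(mulrBr, mulrA) divrK// mulrK. Qed.

(** * The 2-step dressing as a Darboux transform of the first surface *)

Section CommonDarbouxTransform.
Context {R : realType} (N : riemannSurface R).
Variables (f fd : N -> quat R) (rho : R[i]) (phi1 phi2 : N -> H2 R).

Local Notation "v *r q" := (scaler2 v q) (at level 40, left associativity).
Local Notation L := (line_bundle (psivec \o f)).
Local Notation W := (cspan2 phi1 phi2).

Hypothesis rho_neq0 : rho != 0.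
Hypothesis f_diff : forall p, differentiable_rs f p.
Hypothesis fd_diff : forall p, differentiable_rs fd p.
Hypothesis phi1_par : parallel_section L fd rho phi1.
Hypothesis phi2_par : parallel_section L fd rho phi2.
Hypothesis W_sum : forall p, direct_sum_full (W p) (rmulj (W p)).
Hypothesis phi1_compl : complementary phi1 L.

Local Notation r := (qC rho).

Let r_unit : r \is a GRing.unit.
Proof. by rewrite unitqE qC_neq0. Qed.

Let spans12 p : spans (phi1 p) (phi2 p).
Proof. exact: spans_cspan2. Qed.

(** A zero would put [phi1 p] on the line [L p], against complementarity. *)
Let alpha1_neq0 p : alpha f phi1 p != 0.
Proof.
apply/eqP => a0; have /spans_direct_sum := phi1_compl p.
move=> /spans_not_qline[]; exists (phi1 p).2 => //.
by rewrite /scaler2 /= mul1r [RHS]surjective_pairing -(subr0_eq a0).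
Qed.

Let alpha1_unit p : alpha f phi1 p \is a GRing.unit.
Proof. by rewrite unitqE. Qed.

Definition transform_coef p : quat R :=
  r^-1 * (alpha f phi1 p)^-1 * alpha f phi2 p * r.

(* Parallel for the connection of the Darboux transform: it is the image of
   [phi2] under the gauge [e a + psi b |-> phi - phi1 rho^-1 alpha1^-1 a rho],
   which kills [phi1]. *)
Definition transform_section p : H2 R := phi2 p - phi1 p *r transform_coef p.

Lemma simple_factor_dressing_transform :
  simple_factor_dressing rho W L = line_bundle transform_section.
Proof.
apply/funext => p.
have [x [y exy]] := spans12 p (psivec (f p)).
(* The functional [v.1 - f p * v.2] kills [psivec (f p)]; apply it to [exy]. *)
have ax : alpha f phi1 p * x + alpha f phi2 p * y = 0.
  have [e1 e2] := exy; rewrite /alpha !mulrBl.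
  by rewrite addrACA -opprD -!mulrA -mulrDr -e1 -e2 mulr1 subrr.
have xE : x = - ((alpha f phi1 p)^-1 * alpha f phi2 p * y).
  apply: (mulrI (alpha1_unit p)); rewrite mulrN !mulrA divrr// mul1r.
  by apply/eqP; rewrite -addr_eq0 ax.
have y0 : y != 0.
  apply/eqP => y0; move: exy; rewrite xE y0 mulr0 oppr0 !scaler2_0 addr0.
  by case=> _ /eqP; rewrite oner_eq0.
have rc0 : qC (conjc rho) != 0 by rewrite qC_neq0// conjc_eq0.
have dE q : dressing_infty rho (W p) (psivec (f p) *r q) =
    transform_section p *r (r^-1 * y * q * qC (conjc rho)).
  rewrite exy scaler2Dl !scaler2M.
  have [v [w [Wv Ww -> E]]] := cspan2_split phi1 phi2 p (x * q) (y * q).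
  rewrite dressing_inftyE// -E// /transform_section scaler2Dl -scaler2Nr scaler2M.
  rewrite addrC xE /transform_coef !mulrA; congr (_ + _ *r _).
  by rewrite !(mulNr, mulrN) !mulrA mulrK.
apply/seteqP; split => [_ [_ [q _ <-] <-]|_ [q _ <-]].
  by rewrite dE; exists (r^-1 * y * q * qC (conjc rho)).
(* The scalar solves [r^-1 * y * s * qC (conjc rho) = q] for [s]. *)
exists (psivec (f p) *r (y^-1 * r * q * (qC (conjc rho))^-1)).
  by exists (y^-1 * r * q * (qC (conjc rho))^-1).
by rewrite dE; congr (_ *r _); rewrite !mulrA divrK// mulrK ?unitqE// mulVr// mul1r.
Qed.

(** Passing from [phi2] to [transform_section] is a unipotent change of the basis [phi1], [phi2]. *)
Lemma complementary_transform :
  complementary transform_section (line_bundle phi1).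
Proof.
move=> p; apply/spans_direct_sum => v; have [x [y ->]] := spans12 p v.
exists y, (x + transform_coef p * y).
rewrite /transform_section scaler2Dl -scaler2Nr scaler2M scaler2Dr.
by rewrite mulNr scaler2Nr addrACA addNr addr0 addrC.
Qed.

Let psi_finite p : finite_line (L p).
Proof.
move=> [q _ [fq]]; rewrite mul1r => q0; move: fq; rewrite q0 mulr0 => /esym/eqP.
by rewrite oner_eq0.
Qed.

Let is_diff_parallel phi p c : parallel_section L fd rho phi -> is_chart_at p c ->
  is_diff (cmap c p) (fun w => (phi (cinv c w)).1)
    (fun X => - (f p * dchart fd c p X * alpha f phi p * r)) /\
  is_diff (cmap c p) (fun w => (phi (cinv c w)).2)
    (fun X => - (dchart fd c p X * alpha f phi p * r)).
Proof.
move=> [phi_diff phi_eq] pc; have D := differentiableP (phi_diff p c pc).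
have E X := phi_eq p (psi_finite (p := p)) c X pc.
rewrite affine_coord_psi in E.
split; [apply: (is_diff_eq (is_diff_fst D))|apply: (is_diff_eq (is_diff_snd D))];
  apply/funext => X; have /eqP := E X; rewrite addr_eq0 /dchart => /eqP -> /=;
  by rewrite /alpha mulrBr !mulrA.
Qed.

(** The structure equation [d alpha = - df beta]: in the derivative of [phi.1 - f * phi.2] the terms
    with [dfd] cancel. *)
Let is_diff_alpha phi p c : parallel_section L fd rho phi -> is_chart_at p c ->
  is_diff (cmap c p) (alpha f phi \o cinv c)
    (fun X => - (dchart f c p X * beta phi p)).
Proof.
move=> phi_par pc; have zp : cinv c (cmap c p) = p by apply: cmapK; case: pc.
have [D1 D2] := is_diff_parallel phi_par pc.
have Df := differentiableP (f_diff pc).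
apply: (is_diff_eq (is_diffB D1 (is_diff_mulq Df D2))).
apply/funext => X; rewrite !fctE /= zp mulrN !mulrA opprD opprK addrA addrAC addNr.
by rewrite add0r.
Qed.

Definition transform_coef_diff p c X : quat R :=
  r^-1 * (alpha f phi1 p)^-1 * dchart f c p X *
    (beta phi1 p * (alpha f phi1 p)^-1 * alpha f phi2 p - beta phi2 p) * r.

Let is_diff_cstq (k : quat R) (z : R * R) : is_diff z (fun=> k) (fun=> 0).
Proof. exact: (is_diff_cst k z). Qed.

Let is_diff_alphaV p c : is_chart_at p c ->
  is_diff (cmap c p) (fun w => (alpha f phi1 (cinv c w))^-1)
    (fun X => (alpha f phi1 p)^-1 * dchart f c p X * beta phi1 p *
      (alpha f phi1 p)^-1).
Proof.
move=> pc; have zp : cinv c (cmap c p) = p by apply: cmapK; case: pc.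
apply: (is_diff_eq (is_diff_invq (is_diff_alpha phi1_par pc) (alpha1_neq0 _))).
by apply/funext => X /=; rewrite zp mulrN mulNr opprK !mulrA.
Qed.

Lemma is_diff_transform_coef p c : is_chart_at p c ->
  is_diff (cmap c p) (transform_coef \o cinv c) (transform_coef_diff p c).
Proof.
move=> pc; have zp : cinv c (cmap c p) = p by apply: cmapK; case: pc.
apply: (is_diff_eq (is_diff_mulq (is_diff_mulq (is_diff_mulq (is_diff_cstq _ _)
  (is_diff_alphaV pc)) (is_diff_alpha phi2_par pc)) (is_diff_cstq _ _))).
apply/funext => X /=; rewrite zp mul0r mulr0 add0r addr0 mulrN.
by rewrite /transform_coef_diff (mulrBr _ _ (beta phi2 p)) !mulrA.
Qed.

(** Each [d phi_i] ends in [alpha_i rho], and [alpha_1 rho] times [transform_coef] is [alpha_2 rho]: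
    hence the conjugation by [rho], and hence only the derivative of the coefficient survives. *)
Lemma is_diff_transform_section p c : is_chart_at p c ->
  is_diff (cmap c p) (transform_section \o cinv c)
    (fun X => - (phi1 p *r transform_coef_diff p c X)).
Proof.
move=> pc; have zp : cinv c (cmap c p) = p by apply: cmapK; case: pc.
have [D1 D2] := is_diff_parallel phi1_par pc.
have [D1' D2'] := is_diff_parallel phi2_par pc.
have C := is_diff_transform_coef pc.
apply: (is_diff_eq (is_diff_pair (is_diffB D1' (is_diff_mulq D1 C))
  (is_diffB D2' (is_diff_mulq D2 C)))).
have E k m x : - (k * alpha f phi2 p * r) -
    (- (k * alpha f phi1 p * r) * transform_coef p + m * x) = - (m * x).
  by rewrite mulNr /transform_coef !mulrA mulrK// mulrK// opprD opprK addKr.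
by apply/funext => X; rewrite !fctE /= zp; congr pair; exact: E.
Qed.

(** Since [d beta1 = - dfd alpha1 rho], the derivative of the first factor cancels [dfd], leaving
    that of the inverse of [alpha1]. *)
Lemma is_diff_darboux_dual p c : is_chart_at p c ->
  is_diff (cmap c p) (darboux_dual f fd rho phi1 \o cinv c)
    (fun X => beta phi1 p * r^-1 * (alpha f phi1 p)^-1 * dchart f c p X *
      beta phi1 p * (alpha f phi1 p)^-1).
Proof.
move=> pc; have zp : cinv c (cmap c p) = p by apply: cmapK; case: pc.
have [_ D2] := is_diff_parallel phi1_par pc.
apply: (is_diff_eq (is_diffD (differentiableP (fd_diff pc)) (is_diff_mulq
  (is_diff_mulq D2 (is_diff_cstq _ _)) (is_diff_alphaV pc)))).
apply/funext => X; rewrite !fctE /= zp mulr0 addr0 !mulNr mulrK// mulrK//.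
by rewrite /dchart addNKr !mulrA.
Qed.

Lemma parallel_transform :
  parallel_section (line_bundle phi1) (darboux_dual f fd rho phi1) rho
    transform_section.
Proof.
split=> [p c pc|p fin c X pc]; first by have [] := is_diff_transform_section pc.
(* Were [beta] zero, [phi1 p] would be [evec] times [alpha], and its line the point at infinity,
   excluded by [fin]. *)
have b0 : beta phi1 p != 0.
  apply/eqP => b0; apply: fin; exists (alpha f phi1 p)^-1 => //.
  move: b0 (alpha1_unit p); rewrite /beta /alpha /scaler2 => ->.
  by rewrite mulr0 subr0 mul0r => a1; rewrite mulrV.
have b_unit : beta phi1 p \is a GRing.unit by rewrite unitqE.
set f1 := (phi1 p).1 * (beta phi1 p)^-1.
have phi1E : phi1 p = psivec f1 *r beta phi1 p.
  by rewrite /scaler2 /= divrK// mul1r -surjective_pairing.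
have LE : line_bundle phi1 p = qline (psivec f1).
  by rewrite /line_bundle {1}phi1E qline_scaler2.
rewrite LE affine_coord_psi.
have -> : dchart transform_section c p X = - (phi1 p *r transform_coef_diff p c X).
  by rewrite /dchart (@diff_val _ _ _ _ _ _ _ (is_diff_transform_section pc)).
have -> : dchart (darboux_dual f fd rho phi1) c p X = beta phi1 p * r^-1 *
    (alpha f phi1 p)^-1 * dchart f c p X * beta phi1 p * (alpha f phi1 p)^-1.
  by rewrite {1}/dchart (@diff_val _ _ _ _ _ _ _ (is_diff_darboux_dual pc)).
set om := _ * (alpha f phi1 p)^-1.
have uE : (transform_section p).1 - f1 * (transform_section p).2 =
    alpha f phi2 p - alpha f phi1 p * (beta phi1 p)^-1 * beta phi2 p.
  exact: affine_section_coord.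
have omE : om * (alpha f phi2 p - alpha f phi1 p * (beta phi1 p)^-1 * beta phi2 p) * r
    = beta phi1 p * transform_coef_diff p c X.
  exact: dual_differential_coord.
have -> : eta_form f1 om (transform_section p) *r r =
   (f1 * (beta phi1 p * transform_coef_diff p c X),
    beta phi1 p * transform_coef_diff p c X).
  by rewrite eta_formE uE /scaler2 /= -mulrA omE.
(* As [phi1] is [psivec f1] times [beta1], the connection term is [phi1] times the differential of
   the coefficient, opposite to that of the section. *)
by rewrite /f1 mulrA divrK// /scaler2 addNr.
Qed.

Lemma darboux_transform_dressing :
  darboux_transform (line_bundle phi1) (darboux_dual f fd rho phi1) rho
    (simple_factor_dressing rho W L).
Proof.
exists transform_section; split.
- exact: parallel_transform.
- exact: complementary_transform.
- exact: simple_factor_dressing_transform.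
Qed.

End CommonDarbouxTransform.

Unset Implicit Arguments.

Theorem theorem3p15 (R : realType) (M Mt : riemannSurface R) (pr : Mt -> M)
    (univ : universal_cover pr)
    (f : M -> quat R) (fd : Mt -> quat R)
    (iso : isothermic_with_dual pr f fd)
    (rho : R[i]) (rho_neq0 : rho != 0)
    (phi1 phi2 : Mt -> H2 R) :
  let f' : Mt -> quat R := f \o pr in
  let L : Mt -> set (H2 R) := line_bundle (psivec \o f') in
  let W : Mt -> set (H2 R) := cspan2 phi1 phi2 in
  let L1 : Mt -> set (H2 R) := line_bundle phi1 in
  let L2 : Mt -> set (H2 R) := line_bundle phi2 in
  let fd1 : Mt -> quat R := darboux_dual f' fd rho phi1 in
  let fd2 : Mt -> quat R := darboux_dual f' fd rho phi2 in
  let Lhat : Mt -> set (H2 R) := simple_factor_dressing rho W L in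
  parallel_section L fd rho phi1 ->
  parallel_section L fd rho phi2 ->
  (forall p : Mt, direct_sum_full (W p) (rmulj (W p))) ->
  complementary phi1 L ->
  complementary phi2 L ->
  darboux_transform L1 fd1 rho Lhat /\ darboux_transform L2 fd2 rho Lhat.
Proof.
move=> f' L W L1 L2 fd1 fd2 Lhat par1 par2 WW compl1 compl2.
have [_ _ _ hpr] := univ; have [[sf _ _] _ [sfd _ _] _ _] := iso.
have Df := differentiable_rs_comp hpr (smooth_differentiable sf).
have Dfd := smooth_differentiable sfd.
split; first exact: darboux_transform_dressing.
(* [W] is symmetric in the two sections, so their roles can be exchanged. *)
rewrite /Lhat /W cspan2C; apply: darboux_transform_dressing => //.
by rewrite cspan2C.
Qed.
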